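(* Let $m\ge3$. Then, as a $\mathbb{C}$-algebra, the Terwilliger algebra $T$ of $2.O_{m+1}$ with respect to $x_0$ is isomorphic to $$\bigoplus_{d=0}^{m}\ \bigoplus_{r=1}^{\,m-d-\lceil (m-d)/2\rceil+1}\mathrm{Mat}_{2d+2}(\mathbb{C}),$$ i.e. to a direct sum in which, for each $d\in\{0,\dots,m\}$, the full matrix algebra $\mathrm{Mat}_{2d+2}(\mathbb{C})$ appears exactly $m-d-\lceil\frac{m-d}{2}\rceil+1$ times.
   Context: $S=\{1,\dots,2m+1\}$, $X=\binom{S}{m}\cup\binom{S}{m+1}$; the doubled Odd graph $2.O_{m+1}$ has vertex set $X$, two vertices adjacent iff one is a proper subset of the other, with distance $\partial$. $x_0=\{1,\dots,m\}$. $T=T(x_0)$ is the subalgebra of complex $X\times X$ matrices generated by the adjacency matrix $A_1$ and the dual idempotents $E^*_i$ ($0\le i\le 2m+1$), where $E^*_i$ is diagonal with $(y,y)$-entry $1$ iff $\partial(x_0,y)=i$. *)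

(* Defs.v *)
From Stdlib Require Reals.
From mathcomp Require Import all_boot all_algebra.
From mathcomp Require Import complex Rstruct.
Set Implicit Arguments.
Unset Strict Implicit.
Unset Printing Implicit Defensive.
Import GRing.Theory.
Local Open Scope ring_scope.

Definition CC : numClosedFieldType := complex Rdefinitions.R.

Section DoubledOdd.
Variable m : nat.

(* S = {1,...,2m+1} is modelled as 'I_(2m+1) = {0,...,2m}. *)
Definition Sset := 'I_(2 * m + 1).

Definition inX (A : {set Sset}) : bool := (#|A| == m) || (#|A| == m.+1).

Definition adjX (A B : {set Sset}) : bool :=
  [&& inX A, inX B & (A \proper B) || (B \proper A)].

Fixpoint ballX (A : {set Sset}) (k : nat) : {set {set Sset}} :=
  match k with
  | 0 => [set A]
  | k.+1 => ballX A k :|: [set C | [exists B in ballX A k, adjX B C]]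
  end.

(* graph distance: least k with B within k steps of A
   (only used for A, B in the connected graph, where it is the true distance) *)
Definition distX (A B : {set Sset}) : nat :=
  find (fun k => B \in ballX A k) (iota 0 #|{: {set Sset}}|.+1).

Definition x0 : {set Sset} := [set i : Sset | (nat_of_ord i < m)%N].

Definition Vert := {A : {set Sset} | inX A}.
Definition NV := #|{: Vert}|.
Definition vx (i : 'I_NV) : {set Sset} := val (enum_val i).

Definition A1 : 'M[CC]_NV := \matrix_(i, j) (adjX (vx i) (vx j))%:R.

Definition Estar (i : nat) : 'M[CC]_NV :=
  \matrix_(j, k) ((j == k) && (distX x0 (vx j) == i))%:R.

Definition T_gens : seq 'M[CC]_NV := A1 :: [seq Estar i | i <- iota 0 (2 * m + 2)].

End DoubledOdd.

Inductive gen_alg (R : comNzRingType) (n : nat) (G : seq 'M[R]_n) : 'M[R]_n -> Prop :=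
  | gen_mem g : g \in G -> gen_alg G g
  | gen_one : gen_alg G 1%:M
  | gen_add A B : gen_alg G A -> gen_alg G B -> gen_alg G (A + B)
  | gen_scale (c : R) A : gen_alg G A -> gen_alg G (c *: A)
  | gen_mul A B : gen_alg G A -> gen_alg G B -> gen_alg G (A *m B).

Definition Terwilliger (m : nat) : 'M[CC]_(NV m) -> Prop := gen_alg (T_gens m).
Arguments Terwilliger m _ : clear implicits.

Definition alg_iso_blocks (R : comNzRingType) (n : nat) (Tp : 'M[R]_n -> Prop)
  (dims : seq nat) : Prop :=
  exists f : 'M[R]_n -> forall j : 'I_(size dims), 'M[R]_(nth 0%N dims j),
    [/\ (forall A B, Tp A -> Tp B -> forall j, f (A + B) j = f A j + f B j),
        (forall (c : R) A, Tp A -> forall j, f (c *: A) j = c *: f A j),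
        (forall A B, Tp A -> Tp B -> forall j, f (A *m B) j = f A j *m f B j),
        (forall j, f 1%:M j = 1%:M) &
        (forall A B, Tp A -> Tp B -> (forall j, f A j = f B j) -> A = B)] /\
        (forall g : forall j : 'I_(size dims), 'M[R]_(nth 0%N dims j),
            exists2 A, Tp A & forall j, f A j = g j).

Definition block_dims (m : nat) : seq nat :=
  flatten [seq nseq (m - d - uphalf (m - d) + 1) (2 * d + 2) | d <- iota 0 m.+1]%N.

(* Main.v *)
(** Split a vertex [y] as [(y ∩ x0, y \ x0)], living in the Boolean lattices of [x0]
    (rank [m]) and of its complement (rank [m + 1]).  Given [p] disjoint pairs
    [(u, v)] in [x0] and [q] in the complement, the product over all pairs of
    [[u ∈ y] - [v ∈ y]] is a function of [y] which, up to scalars, is preserved by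
    adding or removing one point on either side of [x0].  Its restrictions to the
    spheres around [x0] thus span an irreducible [T]-module with one-dimensional
    components at the distances [m - d, ..., m + d + 1], where
    [d = m - 2 p] if [q <= p] and [d = m + 1 - 2 q] otherwise.  At each distance the
    two neighbouring edges determine [p] and [q], so interpolation yields all matrix
    units of all these modules.  Conversely [T] commutes with the stabiliser of [x0],
    whose orbits on pairs of vertices are no more numerous than the matrix units;
    hence [T] acts faithfully on the sum of these modules. *)

Require Import Defs.
From mathcomp Require Import all_boot all_order all_fingroup all_algebra.
From mathcomp Require Import zify ring.
From mathcomp Require Import complex Rstruct.
Set Implicit Arguments.
Unset Strict Implicit.
Unset Printing Implicit Defensive.
Import Order.TTheory GRing.Theory Num.Theory.
Local Open Scope ring_scope.

(** * Products over disjoint pairs *)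

Section PairFunctions.
Variables (T : finType) (R : comNzRingType).
Implicit Types (A B D : {set T}) (s : seq (T * T)).

Definition pairfun s A : R := \prod_(e <- s) ((e.1 \in A)%:R - (e.2 \in A)%:R).

(** Shrinking [D] at each step makes all the points distinct and leaves the tail a pairing of a set
    that avoids the first pair, which drives the inductions below. *)
Fixpoint pairing D s : bool :=
  if s is e :: s' then
    [&& e.1 \in D, e.2 \in D :\ e.1 & pairing (D :\ e.1 :\ e.2) s']
  else true.

Lemma pairfun_cons e s A :
  pairfun (e :: s) A = ((e.1 \in A)%:R - (e.2 \in A)%:R) * pairfun s A.
Proof. by rewrite /pairfun big_cons. Qed.

Lemma eq_pairfun D s A B : pairing D s ->
  {in D, A =i B} -> pairfun s A = pairfun s B.
Proof.
elim: s D => [|[u v] s IH] D /=; first by rewrite /pairfun !big_nil.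
case/and3P=> uD vD sD eqAB; rewrite !pairfun_cons /= eqAB // eqAB; last first.
  by move: vD; rewrite !inE => /andP[].
congr (_ * _); apply: (IH _ sD) => x; rewrite !inE => /and3P[_ _ xD].
exact: eqAB.
Qed.

(** Induction on the pairs. Deleting a point other than [u], [v] keeps the factor of that pair. If
    both lie in [A], their deletions give opposite terms; if just one does, its deletion kills the
    product, so the pair takes one point out of the count. *)
Lemma sum_pairfun_del D s A : pairing D s ->
  \sum_(x in D) (x \in A)%:R * pairfun s (A :\ x) =
  ((\sum_(x in D) (x \in A))%:R - (size s)%:R) * pairfun s A.
Proof.
elim: s D => [|[u v] s IH] D /=.
  move=> _; rewrite subr0 natr_sum mulr_suml.
  by apply: eq_bigr => x _; rewrite /pairfun !big_nil.
case/and3P=> uD vD sD.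
rewrite (big_setD1 u) //= (big_setD1 v) //=.
rewrite [in RHS](big_setD1 u) //= [in RHS](big_setD1 v) //=.
move: (vD); rewrite !inE => /andP[vu _].
rewrite !pairfun_cons /=.
under eq_bigr => x xD.
  rewrite pairfun_cons /= !inE.
  move: xD; rewrite !inE => /and3P[xv xu _].
  rewrite (eq_sym u) (eq_sym v) xv xu /=.
  rewrite mulrCA.
  over.
rewrite -mulr_sumr IH // !inE !eqxx vu eq_sym vu /=.
(* The remaining pairs avoid [u] and [v], so deleting either leaves their product unchanged. *)
rewrite (eq_pairfun (A := A :\ u) (B := A) sD); last first.
  by move=> x; rewrite !inE => /and3P[_ -> _].
rewrite (eq_pairfun (A := A :\ v) (B := A) sD); last first.
  by move=> x; rewrite !inE => /and3P[-> _ _].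
rewrite !natrD -[(size s).+1]addn1 natrD.
by case: (u \in A); case: (v \in A) => /=; ring.
Qed.

(** Mirror image of [sum_pairfun_del] under complementing [A], which only changes the sign of each
    factor. *)
Lemma sum_pairfun_add D s A : pairing D s ->
  \sum_(x in D) (x \notin A)%:R * pairfun s (x |: A) =
  ((\sum_(x in D) (x \notin A))%:R - (size s)%:R) * pairfun s A.
Proof.
elim: s D => [|[u v] s IH] D /=.
  move=> _; rewrite subr0 natr_sum mulr_suml.
  by apply: eq_bigr => x _; rewrite /pairfun !big_nil.
case/and3P=> uD vD sD.
rewrite (big_setD1 u) //= (big_setD1 v) //=.
rewrite [in RHS](big_setD1 u) //= [in RHS](big_setD1 v) //=.
move: (vD); rewrite !inE => /andP[vu _].
rewrite !pairfun_cons /=.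
under eq_bigr => x xD.
  rewrite pairfun_cons /= !inE.
  move: xD; rewrite !inE => /and3P[xv xu _].
  rewrite (eq_sym u) (eq_sym v) (negbTE xv) (negbTE xu) /=.
  rewrite mulrCA.
  over.
rewrite -mulr_sumr IH // !inE !eqxx (negbTE vu) eq_sym (negbTE vu) /=.
rewrite (eq_pairfun (A := u |: A) (B := A) sD); last first.
  by move=> x; rewrite !inE => /and3P[_ /negbTE-> _].
rewrite (eq_pairfun (A := v |: A) (B := A) sD); last first.
  by move=> x; rewrite !inE => /and3P[/negbTE-> _ _].
rewrite !natrD -[(size s).+1]addn1 natrD.
by case: (u \in A); case: (v \in A) => /=; ring.
Qed.

Lemma sum_mem D A : (\sum_(x in D) (x \in A))%N = #|A :&: D|.
Proof.
rewrite -sum1_card [RHS](eq_bigl (fun x => (x \in D) && (x \in A))); last first.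
  by move=> x; rewrite !inE andbC.
by rewrite big_mkcondr /=; apply: eq_bigr => x _; case: (x \in A).
Qed.

Lemma sum_notin D A : (\sum_(x in D) (x \notin A))%N = #|D :\: A|.
Proof.
rewrite setDE setIC -sum_mem.
by apply: eq_bigr => x _; rewrite inE.
Qed.

(** A nonzero product needs exactly one point of each pair in [A]. *)
Lemma pairfun_neq0 D s A : pairing D s -> pairfun s A != 0 ->
  (size s <= #|A :&: D|)%N /\ (size s <= #|D :\: A|)%N.
Proof.
rewrite -sum_mem -sum_notin.
elim: s D => [|[u v] s IH] D //= /and3P[uD vD sD].
rewrite pairfun_cons /= => nz.
have /(IH _ sD)[h1 h2]: pairfun s A != 0.
  by apply: contraNneq nz => ->; rewrite mulr0.
rewrite !(big_setD1 u uD) /= !(big_setD1 v vD) /=.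
have: (u \in A) != (v \in A).
  by apply: contraNneq nz => ->; rewrite subrr mul0r.
by case: (u \in A); case: (v \in A) => //= _; lia.
Qed.

(** Take the first point of every pair and fill up with points outside all pairs; the second bound
    leaves enough of them. *)
Lemma exists_pairfun1 D s a : pairing D s ->
  (size s <= a)%N -> (a + size s <= #|D|)%N ->
  exists B, [/\ B \subset D, #|B| = a & pairfun s B = 1].
Proof.
elim: s D a => [|[u v] s IH] D a /=.
  rewrite addn0 => _ _ /card_geqP[l [ul sl lD]].
  exists [set x in l]; split.
  - by apply/subsetP => x; rewrite inE; apply: lD.
  - by rewrite cardsE -sl; apply/card_uniqP.
  - by rewrite /pairfun big_nil.
case/and3P=> uD vD sD sa aD.
have [||B [BD cB gB]] := IH _ a.-1 sD; first by lia.
  by move: aD; rewrite (cardsD1 u D) uD (cardsD1 v) vD; lia.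
have uB : u \notin B.
  by apply: contraL uD => /(subsetP BD); rewrite !inE eqxx andbF.
have vB : v \notin B.
  by apply: contraL vD => /(subsetP BD); rewrite !inE eqxx.
exists (u |: B); split.
- rewrite subUset sub1set uD /=; apply: subset_trans BD _.
  by apply/subsetP => x; rewrite !inE => /and3P[].
- by rewrite cardsU1 uB cB; lia.
rewrite pairfun_cons /= !inE eqxx (negbTE vB) orbF /=.
move: vD; rewrite !inE => /andP[/negbTE-> _]; rewrite subr0 mul1r -gB.
by apply: (eq_pairfun sD) => x; rewrite !inE => /and3P[_ /negbTE->].
Qed.

Fixpoint pairs n (l : seq T) : seq (T * T) :=
  match n, l with
  | n'.+1, u :: v :: l' => (u, v) :: pairs n' l'
  | _, _ => [::]
  end.

Lemma size_pairs n l : (2 * n <= size l)%N -> size (pairs n l) = n.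
Proof.
elim: n l => [|n IH] [|u [|v l]] //=; try lia.
by move=> h; rewrite IH //; lia.
Qed.

Lemma pairing_pairs n D l : uniq l -> {subset l <= D} -> pairing D (pairs n l).
Proof.
elim: n D l => [|n IH] D [|u [|v l]] //= /and3P[].
rewrite inE => /norP[uv ul] vl ll lD.
rewrite lD ?mem_head //= !inE lD ?inE ?eqxx ?orbT // eq_sym uv /=.
apply: IH => // x xl; rewrite !inE lD ?inE ?xl ?orbT // !andbT.
by apply/andP; split; [apply: contraNneq vl | apply: contraNneq ul] => <-.
Qed.

End PairFunctions.

(** * The graph and its distance function *)

Lemma card_setUD1 (T : finType) (P A : {set T}) x : x \notin A ->
  #|(x |: A) :\: P| = ((x \notin P) + #|A :\: P|)%N.
Proof.
move=> xA; rewrite (cardsD1 x (_ :\: P)) !inE eqxx andbT; congr (_ + _)%N.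
by apply: eq_card => z; rewrite !inE; case: eqVneq => // ->; rewrite (negbTE xA) andbF.
Qed.

Lemma card_setDU1 (T : finType) (P A : {set T}) x : x \notin A ->
  (#|P :\: (x |: A)| + (x \in P) = #|P :\: A|)%N.
Proof.
move=> xA; rewrite (cardsD1 x (P :\: A)) !inE xA addnC; congr (_ + _)%N.
by apply: eq_card => z; rewrite !inE negb_or andbA.
Qed.

Section Graph.
Variable m : nat.
Notation S := (Sset m).
Notation x0 := (x0 m).
Notation NV := (NV m).
Implicit Types (A B : {set S}).

Lemma card_x0 : #|x0| = m.
Proof.
have le_m : (m <= 2 * m + 1)%N by lia.
have inj : injective (widen_ord le_m : 'I_m -> S).
  by move=> i j /(congr1 val) /= /val_inj.
rewrite -[RHS]card_ord -cardsT -(card_imset _ inj).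
apply: eq_card => i; rewrite !inE; apply/idP/imsetP => [im|[j _ ->]]; last first.
  exact: (ltn_ord j).
by exists (Ordinal im) => //; apply: val_inj.
Qed.

Lemma card_x0C : #|~: x0| = m.+1.
Proof. by have := cardsC x0; rewrite card_x0 card_ord; lia. Qed.

(** Size of the symmetric difference with [x0], shown in [distXE] to be the graph distance. *)
Definition len A := (#|x0 :\: A| + #|A :\: x0|)%N.

(** The two summands of [len A] differ by [#|A| - m], which is 0 or 1. Hence the parity of [len A]
    gives the level of [A], and its value both intersection sizes. *)
Lemma cards_inX A : inX A ->
  [/\ (len A <= 2 * m + 1)%N, #|A| = (m + odd (len A))%N,
      #|A :&: x0| = (m - (len A)./2)%N & #|A :\: x0| = uphalf (len A)].
Proof.
rewrite /inX /len => cA; have := cardsID A x0; have := cardsID x0 A.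
have : (#|A :\: x0| <= #|~: x0|)%N by rewrite setDE subset_leq_card ?subsetIr.
rewrite card_x0 card_x0C [x0 :&: A]setIC => *; split; lia.
Qed.

Lemma adjX_sym A B : adjX A B = adjX B A.
Proof. by rewrite /adjX orbC andbCA. Qed.

Lemma adj_addE A B : #|A| = m ->
  adjX A B = (B \in [set x |: A | x in ~: A]).
Proof.
move=> cA; apply/and3P/imsetP => [[_ iB]|[x]].
  case/orP=> pAB; last first.
    by have := proper_card pAB; move: iB; rewrite /inX; lia.
  case/properP: (pAB) => sAB [x xB xA]; exists x; rewrite ?inE //.
  apply/eqP; rewrite eq_sym eqEcard subUset sub1set xB sAB cardsU1 xA cA.
  by have := proper_card pAB; move: iB; rewrite /inX; lia.
rewrite inE => xA ->; rewrite /inX cardsU1 xA cA !eqxx orbT; split=> //.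
by rewrite properE subsetUr subUset sub1set negb_and xA.
Qed.

Lemma adj_delE A B : #|A| = m.+1 ->
  adjX A B = (B \in [set A :\ x | x in A]).
Proof.
move=> cA; apply/and3P/imsetP => [[_ iB]|[x]].
  case/orP=> pAB.
    by have := proper_card pAB; move: iB; rewrite /inX; lia.
  case/properP: (pAB) => sAB [x xA xB]; exists x; rewrite ?inE //.
  have cAx : #|A :\ x| = m by have := cardsD1 x A; rewrite xA cA; lia.
  have cB : #|B| = m by have := proper_card pAB; move: iB; rewrite /inX; lia.
  by apply/eqP; rewrite eqEcard subsetD1 sAB xB /= cAx cB.
move=> xA ->; have cD : #|A :\ x| = m.
  by have := cardsD1 x A; rewrite xA cA; lia.
rewrite /inX cA cD !eqxx orbT; split=> //; apply/orP; right.
by rewrite properD1.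
Qed.

Lemma len_add A x : x \notin A ->
  (len (x |: A) + (x \in x0) = len A + (x \notin x0))%N.
Proof.
move=> xA; have := card_setUD1 x0 xA; have := card_setDU1 x0 xA.
by rewrite /len; lia.
Qed.

Lemma len_del A x : x \in A ->
  (len (A :\ x) + (x \notin x0) = len A + (x \in x0))%N.
Proof.
by move=> xA; have := @len_add (A :\ x) x; rewrite setD1K // => -> //; rewrite !inE eqxx.
Qed.

Lemma len_adj A B : adjX A B -> (len B <= (len A).+1)%N.
Proof.
move=> AB; have /and3P[/orP[]/eqP cA _ _] := AB.
  move: AB; rewrite adj_addE // => /imsetP[x]; rewrite inE => /len_add + ->.
  by case: (x \in x0) => /=; lia.
move: AB; rewrite adj_delE // => /imsetP[x] /len_del + ->.
by case: (x \in x0) => /=; lia.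
Qed.

Lemma inX_x0 : inX x0. Proof. by rewrite /inX card_x0 eqxx. Qed.

Lemma len_x0 : len x0 = 0%N.
Proof. by rewrite /len setDv cards0. Qed.

Lemma len_eq0 A : inX A -> len A = 0%N -> A = x0.
Proof.
move=> /cards_inX[_ cA cx _] l0; move: cA cx; rewrite l0 => cA cx.
apply/eqP; rewrite eq_sym eqEcard card_x0 cA addn0 leqnn andbT.
rewrite -setD_eq0 -cards_eq0; move: l0; rewrite /len; lia.
Qed.

(** At odd distance some point outside [x0] can be deleted; at positive even distance some missing
    point of [x0] can be added. *)
Lemma exists_closer A k : inX A -> len A = k.+1 ->
  exists2 B, adjX B A & len B = k.
Proof.
move=> iA lA; have [_ cA cx cC] := cards_inX iA.
case oA: (odd (len A)) cA => cA; last rewrite addn0 in cA.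
  have {}cA : #|A| = m.+1 := etrans cA (addn1 m).
  have /card_gt0P[x] : (0 < #|A :\: x0|)%N by rewrite cC lA uphalfE.
  rewrite inE => /andP[xx xA]; exists (A :\ x).
    by rewrite adjX_sym adj_delE //; apply/imsetP; exists x.
  by have := len_del xA; rewrite (negbTE xx); lia.
have /card_gt0P[x] : (0 < #|x0 :\: A|)%N.
  have lE : len A = (#|x0 :\: A| + uphalf (len A))%N by rewrite -cC.
  by move: lE oA; rewrite lA; case: (k) => //=; lia.
rewrite inE => /andP[xA xx]; exists (x |: A).
  by rewrite adjX_sym adj_addE //; apply/imsetP; exists x; rewrite ?inE.
by have := len_add xA; rewrite xx; lia.
Qed.

(** An edge raises [len] by at most one, and [exists_closer] supplies a neighbour one step nearer to
    [x0]. *)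
Lemma ballXE k A : (A \in ballX x0 k) = inX A && (len A <= k)%N.
Proof.
elim: k A => [|k IH] A /=.
  rewrite inE; apply/eqP/andP => [->|[iA]]; first by rewrite inX_x0 len_x0.
  by rewrite leqn0 => /eqP; apply: len_eq0.
rewrite !inE IH; apply/orP/andP => [[/andP[-> h]|]|[iA]].
- by split=> //; apply: leqW.
- case/exists_inP => B; rewrite IH => /andP[_ lB] BA; split.
    by case/and3P: BA.
  exact: leq_trans (len_adj BA) _.
rewrite leq_eqVlt => /orP[/eqP lA|lA]; last by left; rewrite iA.
right; have [B BA lB] := exists_closer iA lA; apply/exists_inP; exists B => //.
by rewrite IH lB leqnn andbT; case/and3P: BA.
Qed.

Lemma distXE A : inX A -> distX x0 A = len A.
Proof.
move=> iA; have [lA _ _ _] := cards_inX iA.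
(* The search in [distX] covers radii up to the number of subsets, [2 ^ (2 * m + 1)], which exceeds
   [len A]. As the list starts at 0, the position found is the radius itself. *)
have bnd : (len A < #|{: {set S}}|.+1)%N.
  rewrite ltnS -cardsT -powersetT card_powerset cardsT card_ord.
  by apply: leq_trans lA _; rewrite ltnW // ltn_expl.
rewrite /distX; set P := fun k => _.
have PE k : P k = (len A <= k)%N by rewrite /P ballXE iA.
have hP : has P (iota 0 #|{: {set S}}|.+1).
  by apply/hasP; exists (len A); rewrite ?mem_iota ?PE.
have fs : (find P (iota 0 #|{: {set S}}|.+1) < #|{: {set S}}|.+1)%N.
  by move: hP; rewrite has_find size_iota.
apply/eqP; rewrite eqn_leq; apply/andP; split.
  rewrite leqNgt; apply/negP => /(before_find 0%N).
  by rewrite nth_iota // PE add0n leqnn.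
by have := nth_find 0%N hP; rewrite nth_iota // PE.
Qed.

Lemma inX_vx i : inX (vx i : {set S}).
Proof. exact: valP. Qed.

Lemma vx_inj : injective (@vx m).
Proof. by move=> i j /val_inj/enum_val_inj. Qed.

Lemma vx_surj A : inX A -> {i : 'I_NV | vx i = A}.
Proof. by move=> iA; exists (enum_rank (Sub A iA : Vert m)); rewrite /vx enum_rankK. Qed.

Lemma sum_vx (R : nmodType) (P : pred {set S}) (f : {set S} -> R) :
  (forall B, P B -> inX B) ->
  \sum_(i : 'I_NV | P (vx i)) f (vx i) = \sum_(B | P B) f B.
Proof.
(* [idx] inverts [vx]; the index of [x0] is a dummy value on non-vertices, which [P] excludes. *)
pose idx B := if insub B is Some v then enum_rank v else enum_rank (Sub x0 inX_x0 : Vert m).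
move=> PX; rewrite (reindex_onto (@vx m) idx) /=.
  apply: eq_bigl => i; rewrite [X in _ && X](_ : _ = true) ?andbT //.
  apply/eqP; apply: vx_inj; rewrite /vx /idx; case: insubP => [v _ vE|].
    by rewrite enum_rankK.
  by rewrite inX_vx.
by move=> B /PX iB; rewrite /idx insubT /vx enum_rankK.
Qed.

Lemma A1_mulE (i : 'I_NV) (f : {set S} -> CC) :
  \sum_j A1 m i j * f (vx j) =
  if odd (len (vx i)) then \sum_(x in vx i) f (vx i :\ x)
  else \sum_(x in ~: vx i) f (x |: vx i).
Proof.
have [_ cA _ _] := cards_inX (inX_vx i).
transitivity (\sum_(j | adjX (vx i) (vx j)) f (vx j)).
  rewrite [RHS]big_mkcond; apply: eq_bigr => j _; rewrite mxE.
  by case: adjX; rewrite ?mul1r ?mul0r.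
rewrite (@sum_vx _ (adjX (vx i)) f); last by move=> B /and3P[].
case: odd cA => cA; last rewrite addn0 in cA.
  have {}cA : #|_| = m.+1 := etrans cA (addn1 m).
  rewrite (eq_bigl _ _ (fun B => adj_delE B cA)) big_imset //=.
  move=> x y xA yA /setP/(_ x); rewrite !inE eqxx xA andbT /=.
  by case: eqVneq.
rewrite (eq_bigl _ _ (fun B => adj_addE B cA)) big_imset //=.
move=> x y; rewrite !inE => xA yA /setP/(_ x); rewrite !inE eqxx (negbTE xA) orbF.
by case: eqVneq.
Qed.

Lemma EstarE i (j k : 'I_NV) : Estar m i j k = ((j == k) && (len (vx j) == i))%:R.
Proof. by rewrite mxE distXE ?inX_vx. Qed.

Lemma gen_A1 : Terwilliger m (A1 m).
Proof. by apply: gen_mem; rewrite inE eqxx. Qed.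

Lemma gen_Estar i : (i < 2 * m + 2)%N -> Terwilliger m (Estar m i).
Proof.
by move=> im; apply: gen_mem; rewrite inE map_f ?orbT // mem_iota add0n.
Qed.

Lemma Terwilliger_ind (P : 'M[CC]_NV -> Prop) :
  P (A1 m) -> (forall i, P (Estar m i)) -> P 1%:M ->
  (forall A B : 'M[CC]_NV, P A -> P B -> P (A + B)) ->
  (forall c (A : 'M[CC]_NV), P A -> P (c *: A)) ->
  (forall A B : 'M[CC]_NV, P A -> P B -> P (A *m B)) ->
  forall A : 'M[CC]_NV, Terwilliger m A -> P A.
Proof.
move=> PA PE P1 PD PZ PM A; elim=> //; last 3 first.
- by move=> *; apply: PD.
- by move=> *; apply: PZ.
- by move=> *; apply: PM.
by move=> g; rewrite inE => /orP[/eqP-> //|/mapP[i _ ->]].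
Qed.

End Graph.

(** * The modules *)

Section Modules.
Variable m : nat.
Notation S := (Sset m).
Notation x0 := (x0 m).
Notation NV := (NV m).
Notation T := (Terwilliger m).
Implicit Types (x : nat * nat).

(** The pair [x = (d, r)] names one of the modules of dimension [2 * d + 2], with [r] counted from
    0. There are [(m - d)./2 + 1 = m - d - uphalf (m - d) + 1] of them. *)
Definition valid x := (x.1 <= m)%N && (x.2 <= (m - x.1)./2)%N.
(** Together with [qidx] this inverts the rule that gives [d] from [(p, q)]: the parity of [m - d]
    tells which of the two determined [d], and [r] is the smaller one. *)
Definition pidx x := if odd (m - x.1) then x.2 else (m - x.1)./2.
Definition qidx x := if odd (m - x.1) then uphalf (m - x.1) else x.2.
Definition supp x i := (m - x.1 <= i <= m + x.1 + 1)%N.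

(** A vertex at distance [i] misses [i./2] points of [x0] and has [uphalf i] points outside it. The
    inequalities say that on each side there is room for every pair to have one point in the vertex
    and one out of it. *)
Lemma suppE x i : valid x ->
  supp x i = [&& (i <= 2 * m + 1)%N, (pidx x <= i./2)%N, (i./2 + pidx x <= m)%N,
    (qidx x <= uphalf i)%N & (uphalf i + qidx x <= m.+1)%N].
Proof.
by case: x => d r; rewrite /valid /supp /pidx /qidx /=; case: ifP => ? ?; lia.
Qed.

Lemma pqidx_bounds x : valid x -> (2 * pidx x <= m)%N /\ (2 * qidx x <= m.+1)%N.
Proof. by case: x => d r; rewrite /valid /pidx /qidx /=; case: ifP => ? ?; lia. Qed.

Definition pairs1 x : seq (S * S) := pairs (pidx x) (enum x0).
Definition pairs2 x : seq (S * S) := pairs (qidx x) (enum (~: x0)).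
Definition hfun x A : CC := pairfun CC (pairs1 x) A * pairfun CC (pairs2 x) A.

Lemma pairing1 x : pairing x0 (pairs1 x).
Proof. by apply: pairing_pairs; [apply: enum_uniq | move=> z; rewrite mem_enum]. Qed.

Lemma pairing2 x : pairing (~: x0) (pairs2 x).
Proof. by apply: pairing_pairs; [apply: enum_uniq | move=> z; rewrite mem_enum]. Qed.

Lemma size_pairs1 x : valid x -> size (pairs1 x) = pidx x.
Proof.
by case/pqidx_bounds=> pm _; rewrite size_pairs // -cardE card_x0.
Qed.

Lemma size_pairs2 x : valid x -> size (pairs2 x) = qidx x.
Proof.
by case/pqidx_bounds=> _ qm; rewrite size_pairs // -cardE card_x0C.
Qed.

Lemma hfun_supp x (A : {set S}) : valid x -> inX A -> hfun x A != 0 -> supp x (len A).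
Proof.
move=> vx iA; rewrite mulf_eq0 negb_or => /andP[].
case/(pairfun_neq0 (pairing1 x)) => a1 a2.
case/(pairfun_neq0 (pairing2 x)) => b1 b2.
rewrite suppE //; move: a1 a2 b1 b2; rewrite size_pairs1 // size_pairs2 //.
have [lA cA cx cC] := cards_inX iA; rewrite cx -setDE cC.
have := cardsID A x0; rewrite card_x0 setIC cx => e1.
have := cardsID A (~: x0); rewrite card_x0C setIC -setDE cC => e2.
by move=> a1 a2 b1 b2; move: e1 e2 a1 a2 b1 b2; set u := #|_|; set v := #|_|; lia.
Qed.

(** The parts inside and outside [x0] are chosen independently by [exists_pairfun1]; [suppE]
    provides the room. *)
Lemma exists_hfun1 x i : valid x -> supp x i ->
  exists A : {set S}, [/\ inX A, len A = i & hfun x A = 1].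
Proof.
move=> vx; rewrite suppE // => /and5P[im p1 p2 q1 q2].
have [||B1 [B1x cB1 gB1]] := @exists_pairfun1 _ CC _ _ (m - i./2)%N (pairing1 x).
- by rewrite size_pairs1 //; lia.
- by rewrite size_pairs1 // card_x0; lia.
have [||B2 [B2x cB2 gB2]] := @exists_pairfun1 _ CC _ _ (uphalf i) (pairing2 x).
- by rewrite size_pairs2.
- by rewrite size_pairs2 // card_x0C.
have B2N z : z \in B2 -> z \notin x0 by move/(subsetP B2x); rewrite inE.
have dB : B1 :&: B2 = set0.
  apply/setP => z; rewrite !inE; apply/negP => /andP[/(subsetP B1x) zx].
  by move/B2N; rewrite zx.
exists (B1 :|: B2); split.
- rewrite /inX cardsU dB cards0 subn0 cB1 cB2; lia.
- rewrite /len [x0 :\: _](_ : _ = x0 :\: B1); last first.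
    apply/setP => z; rewrite !inE negb_or; case: (boolP (z \in B2)) => [/B2N|_].
      by rewrite inE => /negbTE->; rewrite !andbF.
    by rewrite andbT.
  rewrite [_ :\: x0](_ : _ = B2); last first.
    apply/setP => z; rewrite !inE; case: (boolP (z \in B2)) => [/B2N|_].
      by rewrite inE => ->; rewrite orbT.
    by rewrite orbF; apply/negP => /andP[zx] /(subsetP B1x); rewrite inE (negbTE zx).
  rewrite cB2 cardsD (setIidPr B1x) card_x0 cB1; lia.
rewrite /hfun -[RHS]mulr1.
congr (_ * _).
  rewrite -gB1; apply: (eq_pairfun _ (pairing1 x)) => z zx; rewrite inE.
  by case: (boolP (z \in B2)) => [/B2N|]; rewrite ?zx // orbF.
rewrite -gB2; apply: (eq_pairfun _ (pairing2 x)) => z; rewrite in_setC => zx.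
rewrite inE; case: (boolP (z \in B1)) => // /(subsetP B1x).
by rewrite (negbTE zx).
Qed.

(** Row [i], column [k] of the tridiagonal matrix by which [A1] acts on the module [x]. Each factor
    is the number of points that can be added or deleted on one side of [x0], minus the number of
    pairs there. *)
Definition coef x i k : int :=
  if odd i then (i == k.+1)%:Z * ((i./2)%:Z + 1 - (qidx x)%:Z)
              + (k == i.+1)%:Z * (m%:Z - (i./2)%:Z - (pidx x)%:Z)
  else (i == k.+1)%:Z * ((i./2)%:Z - (pidx x)%:Z)
     + (k == i.+1)%:Z * (m%:Z + 1 - (i./2)%:Z - (qidx x)%:Z).

Definition hvec x k (A : {set S}) : CC := (len A == k)%:R * hfun x A.

Lemma sum_split (A D : {set S}) (f : S -> CC) :
  \sum_(z in A) f z = \sum_(z in D) (z \in A)%:R * f z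
                    + \sum_(z in ~: D) (z \in A)%:R * f z.
Proof.
rewrite (bigID (mem D)) /=; congr (_ + _).
  rewrite [RHS](eq_bigr (fun z => if z \in A then f z else 0)); last first.
    by move=> z _; case: (z \in A); rewrite ?mul1r ?mul0r.
  by rewrite -big_mkcondr; apply: eq_bigl => z; rewrite andbC.
rewrite [RHS](eq_bigr (fun z => if z \in A then f z else 0)); last first.
  by move=> z _; case: (z \in A); rewrite ?mul1r ?mul0r.
by rewrite -big_mkcondr; apply: eq_bigl => z; rewrite inE andbC.
Qed.

Lemma hfun_del x A z :
  hfun x (A :\ z) = if z \in x0 then pairfun CC (pairs1 x) (A :\ z) * pairfun CC (pairs2 x) A
                    else pairfun CC (pairs1 x) A * pairfun CC (pairs2 x) (A :\ z).
Proof.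
rewrite /hfun; case: ifPn => zx; congr (_ * _).
  apply: (eq_pairfun _ (pairing2 x)) => w; rewrite in_setC in_setD1.
  by case: eqVneq => // ->; rewrite zx.
apply: (eq_pairfun _ (pairing1 x)) => w; rewrite in_setD1.
by case: eqVneq => // ->; rewrite (negbTE zx).
Qed.

Lemma hfun_add x A z :
  hfun x (z |: A) = if z \in x0 then pairfun CC (pairs1 x) (z |: A) * pairfun CC (pairs2 x) A
                    else pairfun CC (pairs1 x) A * pairfun CC (pairs2 x) (z |: A).
Proof.
rewrite /hfun; case: ifPn => zx; congr (_ * _).
  apply: (eq_pairfun _ (pairing2 x)) => w; rewrite in_setC in_setU1.
  by case: eqVneq => // ->; rewrite zx.
apply: (eq_pairfun _ (pairing1 x)) => w; rewrite in_setU1.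
by case: eqVneq => // ->; rewrite (negbTE zx).
Qed.

(** Deleting a point of [x0] raises [len] by one and deleting any other point lowers it. For each
    kind one factor of [hfun] stays fixed and [sum_pairfun_del] treats the other. *)
Lemma sum_hvec_del x k (A : {set S}) : valid x ->
  \sum_(z in A) hvec x k (A :\ z) =
  (((len A).+1 == k)%:R * ((#|A :&: x0|)%:R - (pidx x)%:R)
  + (len A == k.+1)%:R * ((#|A :\: x0|)%:R - (qidx x)%:R)) * hfun x A.
Proof.
move=> vx; rewrite (sum_split _ x0) mulrDl; congr (_ + _).
  rewrite (eq_bigr (fun z => ((len A).+1 == k)%:R * pairfun CC (pairs2 x) A *
      ((z \in A)%:R * pairfun CC (pairs1 x) (A :\ z)))); last first.
    move=> z zx; case: (boolP (z \in A)) => zA; last by rewrite !mul0r mulr0.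
    have e : len (A :\ z) = (len A).+1 by have := len_del zA; rewrite zx; lia.
    by rewrite /hvec hfun_del zx e; ring.
  rewrite -mulr_sumr (sum_pairfun_del _ _ (pairing1 x)) sum_mem size_pairs1 //.
  by rewrite /hfun; ring.
rewrite (eq_bigr (fun z => (len A == k.+1)%:R * pairfun CC (pairs1 x) A *
    ((z \in A)%:R * pairfun CC (pairs2 x) (A :\ z)))); last first.
  move=> z; rewrite in_setC => zx.
  case: (boolP (z \in A)) => zA; last by rewrite !mul0r mulr0.
  have e : len A = (len (A :\ z)).+1.
    by have := len_del zA; rewrite (negbTE zx); lia.
  by rewrite /hvec hfun_del (negbTE zx) e eqSS; ring.
rewrite -mulr_sumr (sum_pairfun_del _ _ (pairing2 x)) sum_mem -setDE size_pairs2 //.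
by rewrite /hfun; ring.
Qed.

Lemma sum_hvec_add x k (A : {set S}) : valid x ->
  \sum_(z in ~: A) hvec x k (z |: A) =
  ((len A == k.+1)%:R * ((#|x0 :\: A|)%:R - (pidx x)%:R)
  + ((len A).+1 == k)%:R * ((#|~: x0 :\: A|)%:R - (qidx x)%:R)) * hfun x A.
Proof.
move=> vx; rewrite (sum_split _ x0) mulrDl; congr (_ + _).
  rewrite (eq_bigr (fun z => (len A == k.+1)%:R * pairfun CC (pairs2 x) A *
      ((z \notin A)%:R * pairfun CC (pairs1 x) (z |: A)))); last first.
    move=> z zx; rewrite in_setC.
    case: (boolP (z \in A)) => zA; first by rewrite !mul0r mulr0.
    have e : len A = (len (z |: A)).+1 by have := len_add zA; rewrite zx; lia.
    by rewrite /hvec hfun_add zx e eqSS; ring.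
  rewrite -mulr_sumr (sum_pairfun_add _ _ (pairing1 x)) sum_notin size_pairs1 //.
  by rewrite /hfun; ring.
rewrite (eq_bigr (fun z => ((len A).+1 == k)%:R * pairfun CC (pairs1 x) A *
    ((z \notin A)%:R * pairfun CC (pairs2 x) (z |: A)))); last first.
  move=> z; rewrite !in_setC => zx.
  case: (boolP (z \in A)) => zA; first by rewrite !mul0r mulr0.
  have e : len (z |: A) = (len A).+1.
    by have := len_add zA; rewrite (negbTE zx); lia.
  by rewrite /hvec hfun_add (negbTE zx) e; ring.
rewrite -mulr_sumr (sum_pairfun_add _ _ (pairing2 x)) sum_notin size_pairs2 //.
by rewrite /hfun; ring.
Qed.

Lemma A1_hvec x k (i : 'I_NV) : valid x ->
  \sum_j A1 m i j * hvec x k (vx j) = (coef x (len (vx i)) k)%:~R * hfun x (vx i).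
Proof.
move=> vvx; rewrite A1_mulE; have [lA cA cx cC] := cards_inX (inX_vx i).
rewrite /coef; case: ifP => oA.
  rewrite sum_hvec_del // cx cC natrB; last by lia.
  have -> : uphalf (len (vx i)) = (len (vx i))./2.+1 by lia.
  by rewrite [_.+1 == k]eq_sym -natr1; congr (_ * _); ring.
rewrite sum_hvec_add //.
have e1 : (#|x0 :\: vx i| = (len (vx i))./2)%N.
  by have := cardsID (vx i) x0; rewrite card_x0 setIC cx; set u := #|_|; lia.
have e2 : (#|~: x0 :\: vx i| = m + 1 - (len (vx i))./2)%N.
  have := cardsID (vx i) (~: x0); rewrite card_x0C setIC -setDE cC.
  by set u := #|_|; lia.
rewrite e1 e2 natrB; last by lia.
by rewrite [_.+1 == k]eq_sym natrD; congr (_ * _); ring.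
Qed.

End Modules.

(** * Matrix entries of the action of [T] on the modules *)

Section ModuleMatrix.
Variable m : nat.
Notation S := (Sset m).
Notation NV := (NV m).
Notation T := (Terwilliger m).
Implicit Types (x : nat * nat) (A B : 'M[CC]_NV).

(* The [hvec x i], for [i] in [supp x], form a basis of a [T]-module; the coordinate
   along [hvec x i] is read off at a vertex at distance [i] where [hfun x] is 1. *)
Definition modmx A x i k : CC :=
  if [pick y : 'I_NV | (len (vx y) == i) && (hfun x (vx y) == 1)] is Some y
  then \sum_z A y z * hvec x k (vx z) else 0.

Lemma modmxD A B x i k : modmx (A + B) x i k = modmx A x i k + modmx B x i k.
Proof.
rewrite /modmx; case: pickP => [y _|_]; last by rewrite addr0.
by rewrite -big_split; apply: eq_bigr => z _; rewrite mxE mulrDl.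
Qed.

Lemma modmxZ c A x i k : modmx (c *: A) x i k = c * modmx A x i k.
Proof.
rewrite /modmx; case: pickP => [y _|_]; last by rewrite mulr0.
by rewrite mulr_sumr; apply: eq_bigr => z _; rewrite mxE mulrA.
Qed.

Lemma modmxE A x i k (c : nat -> CC) : valid m x -> supp m x i ->
  (forall y : 'I_NV, \sum_z A y z * hvec x k (vx z) = c (len (vx y)) * hfun x (vx y)) ->
  modmx A x i k = c i.
Proof.
move=> vx sx Ac; rewrite /modmx; case: pickP => [y /andP[/eqP ly /eqP hy]|].
  by rewrite Ac ly hy mulr1.
have [B [iB lB hB]] := exists_hfun1 vx sx; have [y yB] := vx_surj iB.
by move=> /(_ y); rewrite yB lB hB !eqxx.
Qed.

Lemma modmx_out A x i k : valid m x -> ~~ supp m x k -> modmx A x i k = 0.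
Proof.
move=> vvx sk; rewrite /modmx; case: pickP => // y _.
apply: big1 => z _; rewrite /hvec; case: eqVneq => [lz|_]; last by rewrite mul0r mulr0.
case: (eqVneq (hfun x (vx z)) 0) => [->|/(hfun_supp vvx (inX_vx z))]; first by rewrite !mulr0.
by rewrite lz (negbTE sk).
Qed.

Definition acts x A := forall k (y : 'I_NV),
  \sum_z A y z * hvec x k (vx z) = modmx A x (len (vx y)) k * hfun x (vx y).

(** Where [hfun x] vanishes both sides are 0; elsewhere the distance lies in the support, and there
    [modmxE] identifies [c]. *)
Lemma actsI x A : valid m x ->
  (forall k, exists c : nat -> CC, forall y : 'I_NV,
    \sum_z A y z * hvec x k (vx z) = c (len (vx y)) * hfun x (vx y)) -> acts x A.
Proof.
move=> vvx H k y; have [c Ac] := H k; rewrite Ac.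
have [->|/(hfun_supp vvx (inX_vx y)) sy] := eqVneq (hfun x (vx y)) 0.
  by rewrite !mulr0.
by rewrite (modmxE vvx sy Ac).
Qed.

Lemma hvecE x k (A : {set S}) : hvec x k A = (len A == k)%:R * hfun x A.
Proof. by []. Qed.

Lemma mul_hvec A B x k y : acts x B ->
  \sum_z (A *m B) y z * hvec x k (vx z) =
  \sum_(j < 2 * m + 2) (\sum_z A y z * hvec x j (vx z)) * modmx B x j k.
Proof.
move=> aB.
transitivity (\sum_z A y z * (modmx B x (len (vx z)) k * hfun x (vx z))).
  under eq_bigr => z _ do rewrite mxE mulr_suml.
  rewrite exchange_big; apply: eq_bigr => z _ /=.
  by rewrite -aB mulr_sumr; apply: eq_bigr => w _; rewrite mulrA.
under [RHS]eq_bigr => j _ do rewrite mulr_suml.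
rewrite exchange_big; apply: eq_bigr => z _ /=.
have [lz _ _ _] := cards_inX (inX_vx z).
have lz' : (len (vx z) < 2 * m + 2)%N by lia.
(* The vertex [z] meets only the sphere [j = len (vx z)]. *)
rewrite (bigD1 (Ordinal lz')) //= big1 ?addr0; last first.
  move=> j /eqP jz; rewrite hvecE; case: eqVneq => [e|_].
    by case: jz; apply: val_inj.
  by rewrite mul0r mulr0 mul0r.
by rewrite hvecE eqxx mul1r mulrCA mulrC.
Qed.

Lemma acts_Estar x l k (y : 'I_NV) :
  \sum_z Estar m l y z * hvec x k (vx z) =
  ((len (vx y) == l) && (len (vx y) == k))%:R * hfun x (vx y).
Proof.
rewrite (bigD1 y) //= big1 ?addr0; last first.
  by move=> z zy; rewrite EstarE eq_sym (negbTE zy) mul0r.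
by rewrite EstarE eqxx hvecE mulrA -natrM mulnb.
Qed.

Lemma acts_one x k (y : 'I_NV) :
  \sum_z (1%:M : 'M[CC]_NV) y z * hvec x k (vx z) =
  (len (vx y) == k)%:R * hfun x (vx y).
Proof.
rewrite (bigD1 y) //= big1 ?addr0; last first.
  by move=> z zy; rewrite mxE eq_sym (negbTE zy) mul0r.
by rewrite mxE eqxx mul1r.
Qed.

(** The generators preserve the span of the [hvec x k], and this passes to sums, scalar multiples
    and products. *)
Lemma Terwilliger_acts x A : valid m x -> T A -> acts x A.
Proof.
move=> vvx; move: A; apply: Terwilliger_ind.
- apply: actsI => // k; exists (fun i => (coef m x i k)%:~R) => y.
  exact: A1_hvec.
- move=> l; apply: actsI => // k; exists (fun i => ((i == l) && (i == k))%:R) => y.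
  exact: acts_Estar.
- apply: actsI => // k; exists (fun i => (i == k)%:R) => y.
  exact: acts_one.
- move=> A B aA aB k y; rewrite modmxD mulrDl -aA -aB -big_split /=.
  by apply: eq_bigr => z _; rewrite mxE mulrDl.
- move=> c A aA k y; rewrite modmxZ -mulrA -aA mulr_sumr.
  by apply: eq_bigr => z _; rewrite mxE mulrA.
- move=> A B aA aB; apply: actsI => // k.
  exists (fun i => \sum_(j < 2 * m + 2) modmx A x i j * modmx B x j k) => y.
  rewrite mul_hvec // mulr_suml; apply: eq_bigr => j _.
  by rewrite aA mulrAC.
Qed.

Lemma modmx_mul A B x i k : valid m x -> supp m x i -> T A -> T B ->
  modmx (A *m B) x i k = \sum_(j < 2 * m + 2) modmx A x i j * modmx B x j k.
Proof.
move=> vvx si TA TB; apply: (modmxE (c := fun i => \sum_(j < _) _)) => // y.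
rewrite mul_hvec; last exact: Terwilliger_acts.
rewrite mulr_suml; apply: eq_bigr => j _.
by rewrite (Terwilliger_acts vvx TA) mulrAC.
Qed.

Lemma modmx_A1 x i k : valid m x -> supp m x i ->
  modmx (A1 m) x i k = (coef m x i k)%:~R.
Proof.
move=> vvx si; apply: (modmxE (c := fun i => (coef m x i k)%:~R)) => // y.
exact: A1_hvec.
Qed.

Lemma modmx_Estar x l i k : valid m x -> supp m x i ->
  modmx (Estar m l) x i k = ((i == l) && (i == k))%:R.
Proof.
move=> vvx si; apply: (modmxE (c := fun i => ((i == l) && (i == k))%:R)) => // y.
exact: acts_Estar.
Qed.

Lemma modmx1 x i k : valid m x -> supp m x i -> modmx 1%:M x i k = (i == k)%:R.
Proof.
move=> vvx si; apply: (modmxE (c := fun i => (i == k)%:R)) => // y.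
exact: acts_one.
Qed.

End ModuleMatrix.

(** * Matrix units *)

Section Units.
Variable m : nat.
Notation S := (Sset m).
Notation NV := (NV m).
Notation T := (Terwilliger m).
Implicit Types (x y : nat * nat) (A B : 'M[CC]_NV).

(** With [coef_down]: both entries on the edge between [i] and [i.+1] involve only [pidx] for odd
    [i] and only [qidx] for even [i]. *)
Lemma coef_up x i : coef m x i i.+1 =
  if odd i then m%:Z - (i./2)%:Z - (pidx m x)%:Z
  else m%:Z + 1 - (i./2)%:Z - (qidx m x)%:Z.
Proof.
rewrite /coef eqxx (_ : i == i.+2 = false); last by apply/eqP; lia.
by case: odd; rewrite mul0r mul1r add0r.
Qed.

Lemma coef_down x i : coef m x i.+1 i =
  if odd i then (i./2)%:Z + 1 - (pidx m x)%:Z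
  else (i./2)%:Z + 1 - (qidx m x)%:Z.
Proof.
rewrite /coef eqxx (_ : i == i.+2 = false); last by apply/eqP; lia.
rewrite /= mul1r mul0r addr0; case: ifP => oi; rewrite ?if_neg.
  by rewrite (_ : odd i = false) ?uphalfE; lia.
by rewrite (_ : odd i = true); lia.
Qed.

Lemma coef_up_neq0 x i : valid m x -> supp m x i -> supp m x i.+1 ->
  coef m x i i.+1 != 0.
Proof. by move=> vx; rewrite !suppE // coef_up; case: ifP => oi; lia. Qed.

Lemma coef_down_neq0 x i : valid m x -> supp m x i -> supp m x i.+1 ->
  coef m x i.+1 i != 0.
Proof. by move=> vx; rewrite !suppE // coef_down; case: ifP => oi; lia. Qed.

(** An edge leaving the support has weight 0, so the weight formula for a walk along it and back
    needs no case distinction on the support. *)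
Lemma coef_out_up x i : valid m x -> supp m x i -> ~~ supp m x i.+1 ->
  coef m x i i.+1 * coef m x i.+1 i = 0.
Proof.
move=> vx; rewrite !suppE // coef_up coef_down => si si1; apply/eqP.
by rewrite mulf_eq0; case: ifP => oi; lia.
Qed.

Lemma coef_out_down x i : valid m x -> supp m x i.+1 -> ~~ supp m x i ->
  coef m x i i.+1 * coef m x i.+1 i = 0.
Proof.
move=> vx; rewrite !suppE // coef_up coef_down => si si1; apply/eqP.
by rewrite mulf_eq0; case: ifP => oi; lia.
Qed.

Lemma pq_inj x y : valid m x -> valid m y ->
  pidx m x = pidx m y -> qidx m x = qidx m y -> x = y.
Proof.
case: x y => [d r] [d' r']; rewrite /valid /pidx /qidx /= => /andP[h1 h2] /andP[h3 h4].
case: ifP => o1; case: ifP => o2 e1 e2; have [e3 e4] : d = d' /\ r = r' by lia.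
all: by rewrite ?e3 ?e4.
Qed.

(** The weight is quadratic in its parameter: two parameters of equal weight coincide or add up to
    [m + 1] (for [pidx]) or [m + 2] (for [qidx]), and [pqidx_bounds] excludes these sums. *)
Lemma edge_inj x y i : valid m x -> valid m y ->
  coef m x i i.+1 * coef m x i.+1 i = coef m y i i.+1 * coef m y i.+1 i ->
  if odd i then pidx m x = pidx m y else qidx m x = qidx m y.
Proof.
move=> vx vy; have [p1 q1] := pqidx_bounds vx; have [p2 q2] := pqidx_bounds vy.
rewrite !coef_up !coef_down; case: ifP => oi e.
  have : ((pidx m x)%:Z - (pidx m y)%:Z) * (m%:Z + 1 - (pidx m x)%:Z - (pidx m y)%:Z) = 0.
    by move/eqP: e; rewrite -subr_eq0 => /eqP e; rewrite -[RHS]oppr0 -e; ring.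
  by move/eqP; rewrite mulf_eq0; lia.
have : ((qidx m x)%:Z - (qidx m y)%:Z) * (m%:Z + 2 - (qidx m x)%:Z - (qidx m y)%:Z) = 0.
  by move/eqP: e; rewrite -subr_eq0 => /eqP e; rewrite -[RHS]oppr0 -e; ring.
by move/eqP; rewrite mulf_eq0; lia.
Qed.

(** A single element of [T] has to serve all the modules simultaneously; only entries within the
    supports are prescribed. *)
Definition realized (G : nat * nat -> nat -> nat -> CC) := exists2 A, T A &
  forall x i k, valid m x -> supp m x i -> supp m x k -> modmx A x i k = G x i k.

Lemma eq_realized G H : realized G ->
  (forall x i k, valid m x -> supp m x i -> supp m x k -> G x i k = H x i k) ->
  realized H.
Proof. by move=> [A TA AG] GH; exists A => // x i k *; rewrite AG ?GH. Qed.

Lemma realizedD G H : realized G -> realized H ->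
  realized (fun x i k => G x i k + H x i k).
Proof.
move=> [A TA AG] [B TB BH]; exists (A + B); first exact: gen_add.
by move=> x i k *; rewrite modmxD AG // BH.
Qed.

Lemma realizedZ c G : realized G -> realized (fun x i k => c * G x i k).
Proof.
move=> [A TA AG]; exists (c *: A); first exact: gen_scale.
by move=> x i k *; rewrite modmxZ AG.
Qed.

Lemma realized_sum (I : finType) (G : I -> nat * nat -> nat -> nat -> CC) :
  (forall j, realized (G j)) -> realized (fun x i k => \sum_j G j x i k).
Proof.
move=> rG; elim: (index_enum I) => [|j l IH].
  (* The empty sum is realised by 0 times the identity. *)
  apply: (eq_realized (realizedZ 0 (ex_intro2 _ _ 1%:M (gen_one _) (fun _ _ _ _ _ _ => erefl)))).
  by move=> *; rewrite mul0r big_nil.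
by apply: (eq_realized (realizedD (rG j) IH)) => *; rewrite big_cons.
Qed.

Lemma realizedM G H : realized G -> realized H ->
  realized (fun x i k => \sum_(j < 2 * m + 2 | supp m x j) G x i j * H x j k).
Proof.
move=> [A TA AG] [B TB BH]; exists (A *m B); first exact: gen_mul.
move=> x i k vx si sk; rewrite modmx_mul // [RHS]big_mkcond /=.
apply: eq_bigr => j _; case: ifPn => sj; first by rewrite AG // BH.
by rewrite modmx_out // mul0r.
Qed.

Lemma ltn_supp x i : valid m x -> supp m x i -> (i < 2 * m + 2)%N.
Proof. by case: x => d r; rewrite /valid /supp /=; lia. Qed.

Lemma sum_supp_eq x a (f : nat -> CC) : valid m x ->
  \sum_(j < 2 * m + 2 | supp m x j) (nat_of_ord j == a)%:R * f j
  = (supp m x a)%:R * f a.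
Proof.
move=> vx; case: (boolP (supp m x a)) => sa.
  rewrite (bigD1 (Ordinal (ltn_supp vx sa))) //= big1 ?addr0 ?eqxx //.
  by move=> j /andP[_ /eqP ja]; case: eqP => [e|]; rewrite ?mul0r //; case: ja; apply: val_inj.
rewrite mul0r big1 // => j sj; case: eqP => [e|]; last by rewrite mul0r.
by rewrite -e sj in sa.
Qed.

Lemma realized_A1 : realized (fun x i k => (coef m x i k)%:~R).
Proof. by exists (A1 m); [apply: gen_A1 | move=> *; apply: modmx_A1]. Qed.

Lemma realized_Estar l : (l < 2 * m + 2)%N ->
  realized (fun x i k => ((i == l) && (i == k))%:R).
Proof.
by move=> lm; exists (Estar m l); [apply: gen_Estar | move=> *; apply: modmx_Estar].
Qed.

Lemma realized_El l G : (l < 2 * m + 2)%N -> realized G ->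
  realized (fun x i k => (i == l)%:R * G x i k).
Proof.
move=> lm rG; apply: (eq_realized (realizedM (realized_Estar lm) rG)) => x i k vx si sk.
transitivity (\sum_(j < 2 * m + 2 | supp m x j) (nat_of_ord j == i)%:R *
   ((i == l)%:R * G x j k)).
  by apply: eq_bigr => j _; rewrite -mulnb natrM [i == j :> nat]eq_sym; ring.
by rewrite (sum_supp_eq _ (fun j => (i == l)%:R * G x j k)) // si mul1r.
Qed.

Lemma realized_Er l G : (l < 2 * m + 2)%N -> realized G ->
  realized (fun x i k => (k == l)%:R * G x i k).
Proof.
move=> lm rG; apply: (eq_realized (realizedM rG (realized_Estar lm))) => x i k vx si sk.
transitivity (\sum_(j < 2 * m + 2 | supp m x j) (nat_of_ord j == k)%:R *
   ((k == l)%:R * G x i j)).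
  apply: eq_bigr => j _.
  by case: (eqVneq (nat_of_ord j) k) => [->|_]; rewrite ?andbT ?andbF /=; ring.
by rewrite (sum_supp_eq _ (fun j => (k == l)%:R * G x i j)) // sk mul1r.
Qed.

(** Inserting [Estar m l] between the two factors keeps only the paths through distance [l]. *)
Lemma realized_mid l G H : (l < 2 * m + 2)%N -> realized G -> realized H ->
  realized (fun x i k => (supp m x l)%:R * (G x i l * H x l k)).
Proof.
move=> lm rG rH; apply: (eq_realized (realizedM (realized_Er lm rG) rH)) => x i k vx si sk.
rewrite -(sum_supp_eq l (fun j => G x i j * H x j k)) //.
by apply: eq_bigr => j _; rewrite mulrA.
Qed.

Definition diag_unit (s : nat) (phi : nat * nat -> CC) x (i k : nat) : CC :=
  (i == s)%:R * ((k == s)%:R * phi x).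

Lemma realized_diag s G : (s < 2 * m + 2)%N -> realized G ->
  realized (diag_unit s (fun x => G x s s)).
Proof.
move=> sm rG; apply: (eq_realized (realized_El sm (realized_Er sm rG))) => x i k *.
by rewrite /diag_unit; case: eqVneq => [->|]; case: eqVneq => [->|]; rewrite ?mul0r.
Qed.

Lemma realized_diagM s phi psi : (s < 2 * m + 2)%N -> realized (diag_unit s phi) ->
  realized (diag_unit s psi) -> realized (diag_unit s (fun x => phi x * psi x)).
Proof.
move=> sm r1 r2; apply: (eq_realized (realized_mid sm r1 r2)) => x i k vx si sk.
rewrite /diag_unit eqxx; case: (eqVneq i s) si => [->->|_ _]; rewrite ?mul0r ?mulr0 //.
by rewrite /=; ring.
Qed.

Lemma realized_diag_const s c : (s < 2 * m + 2)%N -> realized (diag_unit s (fun=> c)).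
Proof.
move=> sm; apply: (eq_realized (realizedZ c (realized_Estar sm))) => x i k _ _ _.
rewrite /diag_unit mulrC -mulnb natrM mulrA; congr (_ * _).
by case: eqVneq => [->|]; rewrite ?mul0r // eq_sym.
Qed.

Lemma realized_diagD s phi psi : realized (diag_unit s phi) ->
  realized (diag_unit s psi) -> realized (diag_unit s (fun x => phi x + psi x)).
Proof.
move=> r1 r2; apply: (eq_realized (realizedD r1 r2)) => x i k vx si sk.
by rewrite /diag_unit; ring.
Qed.

Definition edge_weight x i : CC := (coef m x i i.+1 * coef m x i.+1 i)%:~R.

(** This is the walk from distance [s] to [s.+1] and back, cut out of the square of [A1] by the dual
    idempotents. On modules that stop at [s] both sides are 0 by [coef_out_up]. *)
Lemma realized_edge_up s : (s.+1 < 2 * m + 2)%N ->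
  realized (diag_unit s (fun x => edge_weight x s)).
Proof.
move=> sm; have r := realized_diag (ltnW sm) (realized_mid sm realized_A1 realized_A1).
apply: (eq_realized r) => x i k vx.
rewrite /diag_unit; case: (eqVneq i s) => [->|ns] si _; last by rewrite !mul0r.
do 2!congr (_ * _); rewrite /edge_weight intrM.
case: (boolP (supp m x s.+1)) => s1; first by rewrite mul1r.
by rewrite mul0r -intrM coef_out_up.
Qed.

Lemma realized_edge_down s : (s.+1 < 2 * m + 2)%N ->
  realized (diag_unit s.+1 (fun x => edge_weight x s)).
Proof.
move=> sm; have r := realized_diag sm (realized_mid (ltnW sm) realized_A1 realized_A1).
apply: (eq_realized r) => x i k vx.
rewrite /diag_unit; case: (eqVneq i s.+1) => [->|ns] si _; last by rewrite !mul0r.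
do 2!congr (_ * _); rewrite /edge_weight intrM mulrC [RHS]mulrC.
case: (boolP (supp m x s)) => s1; first by rewrite mulr1.
by rewrite mulr0 -intrM mulrC coef_out_down.
Qed.

(** The edges above and below distance [s] have opposite parities, so one weight determines [pidx]
    and the other [qidx]. If neither weight separated [x] from [y], then [pq_inj] would give
    [x = y]. *)
Lemma realized_separate s x y : valid m x -> valid m y -> supp m x s -> supp m y s ->
  x != y -> exists2 phi, realized (diag_unit s phi) & phi x != phi y.
Proof.
move=> vx vy sx sy xy.
have sm := ltn_supp vx sx.
have vd : valid m (m, 0%N) by rewrite /valid /=; lia.
have [e|n] := eqVneq (edge_weight x s) (edge_weight y s); last first.
  case: (ltnP s.+1 (2 * m + 2)) => s1.
    by exists (fun x => edge_weight x s) => //; apply: realized_edge_up.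
  (* Here [s = 2 * m + 1] is the last distance, where both weights are 0 and cannot differ. *)
  case/eqP: n; rewrite /edge_weight !coef_out_up // suppE // negb_and -ltnNge; lia.
have {}e := edge_inj vx vy (intr_inj e).
have [e'|n] := eqVneq (edge_weight x s.-1) (edge_weight y s.-1); last first.
  case: s sx sy sm e n => [|s] sx sy sm e n; last first.
    by exists (fun x => edge_weight x s) => //; apply: realized_edge_down.
  (* At [s = 0] there is no lower edge, but the support condition forces both parameters to be 0. *)
  case/eqP: xy; apply: pq_inj => //.
  by move: sx sy; rewrite !suppE //=; lia.
have {}e' := edge_inj vx vy (intr_inj e').
case/eqP: xy; apply: pq_inj => //.
  case: s sx sy sm e e' => [|s] sx sy sm /=; first by move: sx sy; rewrite !suppE //=; lia.
  by case: (odd s).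
case: s sx sy sm e e' => [|s] sx sy sm //=.
by case: (odd s).
Qed.

(** Lagrange interpolation: each [y] in [L] contributes a factor that is 0 at [y] and 1 at [x]. *)
Lemma realized_interpolate s x (L : seq (nat * nat)) : valid m x -> supp m x s ->
  (forall y, y \in L -> [/\ valid m y, supp m y s & x != y]) ->
  exists phi, [/\ realized (diag_unit s phi), phi x = 1 & {in L, phi =1 (fun=> 0)}].
Proof.
move=> vx sx; have sm := ltn_supp vx sx; elim: L => [|y L IH] HL.
  by exists (fun=> 1); split=> //; apply: realized_diag_const.
have [phi [rphi phix phiL]] : exists phi,
    [/\ realized (diag_unit s phi), phi x = 1 & {in L, phi =1 (fun=> 0)}].
  by apply: IH => z zL; apply: HL; rewrite inE zL orbT.
have [vy sy xy] := HL y (mem_head _ _).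
have [psi rpsi psixy] := realized_separate vx vy sx sy xy.
exists (fun z => phi z * ((psi x - psi y)^-1 * (psi z - psi y))); split.
- apply: realized_diagM => //; apply: realized_diagM => //.
    exact: realized_diag_const.
  by apply: realized_diagD => //; apply: realized_diag_const.
- by rewrite phix mul1r mulVf // subr_eq0.
move=> z; rewrite inE => /orP[/eqP->|zL]; first by rewrite subrr !mulr0.
by rewrite phiL // mul0r.
Qed.

Definition unit_entry x (a b : nat) y (i k : nat) : CC := ((y == x) && ((i == a) && (k == b)))%:R.

Lemma realized_unit_diag s x : valid m x -> supp m x s -> realized (unit_entry x s s).
Proof.
move=> vx sx.
(* [L] lists all the other modules that meet the sphere [s]; both coordinates of a valid index are
   at most [m]. *)
pose L := [seq y <- [seq (d, r) | d <- iota 0 m.+1, r <- iota 0 m.+1]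
           | [&& valid m y, supp m y s & x != y]].
have [y|phi [rphi phix phiL]] := @realized_interpolate s x L vx sx.
  by rewrite mem_filter => /andP[/and3P[]].
apply: (eq_realized rphi) => y i k vy si sk.
rewrite /diag_unit /unit_entry; case: (eqVneq i s) si => [-> si|_ _]; last first.
  by rewrite andbF mul0r.
rewrite mul1r; case: (eqVneq y x) => [->|yx]; first by rewrite phix mulr1.
rewrite phiL ?mulr0 // mem_filter vy si eq_sym yx !andTb.
case: y vy {si sk yx} => d r vy; apply/allpairsPdep; exists d, r.
by move: vy; rewrite !mem_iota /valid /= => ?; split=> //; lia.
Qed.

Lemma realized_step_left x a b l : valid m x -> supp m x a -> supp m x l ->
  coef m x l a != 0 -> realized (unit_entry x a b) -> realized (unit_entry x l b).
Proof.
move=> vx sa sl c0 rU.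
have r := realized_El (ltn_supp vx sl) (realized_mid (ltn_supp vx sa) realized_A1 rU).
apply: (eq_realized (realizedZ ((coef m x l a)%:~R^-1) r)) => y i k vy si sk.
rewrite /unit_entry eqxx /=; case: (eqVneq y x) => [->|_]; last by rewrite !mulr0.
rewrite sa mul1r; case: (eqVneq i l) => [->|_]; last by rewrite mul0r mulr0.
by rewrite mul1r mulrA mulVf ?mul1r // intr_eq0.
Qed.

Lemma realized_step_right x a b l : valid m x -> supp m x b -> supp m x l ->
  coef m x b l != 0 -> realized (unit_entry x a b) -> realized (unit_entry x a l).
Proof.
move=> vx sb sl c0 rU.
have r := realized_Er (ltn_supp vx sl) (realized_mid (ltn_supp vx sb) rU realized_A1).
apply: (eq_realized (realizedZ ((coef m x b l)%:~R^-1) r)) => y i k vy si sk.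
rewrite /unit_entry eqxx andbT; case: (eqVneq y x) => [->|_]; last by rewrite !(mulr0, mul0r).
rewrite sb mul1r; case: (eqVneq k l) => [->|_]; last by rewrite andbF mul0r mulr0.
by rewrite andbT mul1r [_%:R * _]mulrC mulrA mulVf ?mul1r // intr_eq0.
Qed.

(** From the diagonal unit at the lowest distance [s = m - d], the row index climbs to [a] along
    nonzero [coef_down], and separately the column index to [b] along nonzero [coef_up]. The product
    through [s] is the required unit. *)
Lemma realized_unit x a b : valid m x -> supp m x a -> supp m x b ->
  realized (unit_entry x a b).
Proof.
move=> vx; pose s := (m - x.1)%N.
have ss n : supp m x (s + n) = (n < 2 * x.1 + 2)%N.
  by move: vx; case: (x) @s => d r; rewrite /valid /supp /=; lia.
have sP i : supp m x i -> exists2 n, i = (s + n)%N & (n < 2 * x.1 + 2)%N.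
  move=> si; exists (i - s)%N; move: vx si;
    by rewrite /s; case: (x) => d r; rewrite /valid /supp /=; lia.
have rl n : (n < 2 * x.1 + 2)%N -> realized (unit_entry x (s + n) s).
  elim: n => [|n IH] nx; first by rewrite addn0; apply: realized_unit_diag; rewrite // -[s]addn0 ss.
  apply: (realized_step_left _ _ _ _ (IH (ltnW nx))); rewrite ?ss // ?(ltnW nx) // addnS.
  by rewrite coef_down_neq0 // ?ss -?addnS ?ss // ltnW.
have rr n : (n < 2 * x.1 + 2)%N -> realized (unit_entry x s (s + n)).
  elim: n => [|n IH] nx; first by rewrite addn0; apply: realized_unit_diag; rewrite // -[s]addn0 ss.
  apply: (realized_step_right _ _ _ _ (IH (ltnW nx))); rewrite ?ss // ?(ltnW nx) // addnS.
  by rewrite coef_up_neq0 // ?ss -?addnS ?ss // ltnW.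
move=> /sP[i -> ix] /sP[j -> jx]; have s0 : supp m x s by rewrite -[s]addn0 ss; lia.
apply: (eq_realized (realized_mid (ltn_supp vx s0) (rl _ ix) (rr _ jx))) => y u v vy su sv.
rewrite /unit_entry !eqxx andbT; case: (eqVneq y x) => [->|_] /=; last by rewrite mul0r mulr0.
by rewrite s0 mul1r -natrM mulnb.
Qed.

End Units.

(** * Orbits of the stabiliser of the base vertex *)

Lemma exists_perm_fibers n (K : eqType) (f g : 'I_n -> K) :
  (forall c, #|[set i | f i == c]| = #|[set i | g i == c]|) ->
  exists s : 'S_n, forall i, g (s i) = f i.
Proof.
move=> fg; have /tuple_permP[s sE] : perm_eq [tuple f i | i < n] [tuple g i | i < n].
  rewrite /perm_eq; apply/allP => c _; rewrite /= !count_map -!sum1_count.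
  by rewrite -!enumT !big_enum_cond !sum1dep_card fg.
exists s => i; have /(congr1 (fun t => tnth t i)) := val_inj sE.
by rewrite !tnth_mktuple.
Qed.

(** Two sets cut [D] into four cells, whose sizes follow from [#|D|], the two traces on [D] and the
    trace of the intersection. *)
Lemma card_cells (T : finType) (D y z y' z' : {set T}) (c2 c3 : bool) :
  #|y :&: D| = #|y' :&: D| -> #|z :&: D| = #|z' :&: D| ->
  #|y :&: z :&: D| = #|y' :&: z' :&: D| ->
  #|[set i in D | ((i \in y) == c2) && ((i \in z) == c3)]| =
  #|[set i in D | ((i \in y') == c2) && ((i \in z') == c3)]|.
Proof.
pose N (u v : {set T}) (b c : bool) := #|[set i in D | ((i \in u) == b) && ((i \in v) == c)]|.
have E1 u v : #|u :&: v :&: D| = N u v true true.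
  by apply: eq_card => i; rewrite !inE !eqb_id andbC.
have E2 u v : #|u :&: D| = (N u v true true + N u v true false)%N.
  rewrite -(cardsID v (u :&: D)); congr (_ + _)%N; apply: eq_card => i;
    rewrite !inE ?eqb_id ?eqbF_neg; first by rewrite andbAC andbC.
  by rewrite andbC andbAC andbC.
have E3 u v : #|v :&: D| = (N u v true true + N u v false true)%N.
  rewrite -(cardsID u (v :&: D)); congr (_ + _)%N; apply: eq_card => i;
    rewrite !inE ?eqb_id ?eqbF_neg.
    by case: (i \in D); rewrite ?andbF ?andbT //= andbC.
  by case: (i \in D); rewrite ?andbF ?andbT.
have E4 u v : #|D| = (N u v true true + N u v true false +
                      (N u v false true + N u v false false))%N.
  rewrite -E2 -(cardsID u D) setIC; congr (_ + _)%N.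
  rewrite -(cardsID v (D :\: u)); congr (_ + _)%N; apply: eq_card => i;
    rewrite !inE ?eqb_id ?eqbF_neg.
    by case: (i \in D); rewrite ?andbF ?andbT.
  by case: (i \in D); rewrite ?andbF ?andbT // andbC.
rewrite (E2 y z) (E2 y' z') (E3 y z) (E3 y' z') !E1.
have := E4 y z; rewrite (E4 y' z') -/(N y z c2 c3) -/(N y' z' c2 c3).
by case: c2; case: c3; lia.
Qed.

Section Orbits.
Variable m : nat.
Notation S := (Sset m).
Notation x0 := (x0 m).
Notation NV := (NV m).
Notation T := (Terwilliger m).
Implicit Types (A B : 'M[CC]_NV).

(** Label each point by its membership in [x0] and in the two vertices. By [card_cells] the label
    classes of both configurations have equal sizes, so some permutation matches the labels. *)
Lemma exists_perm_orbit (y z y' z' : {set S}) : inX y -> inX z -> inX y' -> inX z' ->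
  len y = len y' -> len z = len z' ->
  #|y :&: z :&: x0| = #|y' :&: z' :&: x0| ->
  #|y :&: z :&: ~: x0| = #|y' :&: z' :&: ~: x0| ->
  exists s : {perm S}, [/\ s @: x0 = x0, s @: y = y' & s @: z = z'].
Proof.
move=> iy iz iy' iz' ly lz h1 h2.
have [_ _ cy1 cy2] := cards_inX iy; have [_ _ cz1 cz2] := cards_inX iz.
have [_ _ cy1' cy2'] := cards_inX iy'; have [_ _ cz1' cz2'] := cards_inX iz'.
have [|s sE] := @exists_perm_fibers _ _ (fun i : S => (i \in x0, i \in y, i \in z))
     (fun i : S => (i \in x0, i \in y', i \in z')).
  move=> [[c1 c2] c3].
  pose D := if c1 then x0 else ~: x0.
  have DE (u v : {set S}) : [set i | (i \in x0, i \in u, i \in v) == (c1, c2, c3)] =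
      [set i in D | ((i \in u) == c2) && ((i \in v) == c3)].
    apply/setP => i; rewrite !inE !xpair_eqE -andbA; congr (_ && _).
    by rewrite /D; case: (c1); rewrite !inE ?eqb_id ?eqbF_neg.
  rewrite !setDE in cy2 cz2 cy2' cz2'.
  rewrite !DE; apply: card_cells; rewrite /D; case: (c1) => //.
  - by rewrite cy1 cy1' ly.
  - by rewrite cy2 cy2' ly.
  - by rewrite cz1 cz1' lz.
  - by rewrite cz2 cz2' lz.
have imE (u v : {set S}) : (forall i, (s i \in v) = (i \in u)) -> s @: u = v.
  move=> uv; apply/setP => i; rewrite -(permKV s i) uv.
  by rewrite mem_imset //; apply: perm_inj.
by exists s; split; apply: imE => i; case: (sE i).
Qed.

(** A permutation fixing [x0] preserves adjacency and [len], hence the generators; [t] below is its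
    action on vertex indices. *)
Lemma Terwilliger_invariant (s : {perm S}) A : s @: x0 = x0 -> T A ->
  forall i j i' j' : 'I_NV, vx i' = s @: vx i -> vx j' = s @: vx j ->
  A i' j' = A i j.
Proof.
move=> sx0 TA i j i' j' iE jE; have sI := @perm_inj _ s.
have inXs (B : {set S}) : inX (s @: B) = inX B.
  by rewrite /inX (card_imset _ sI).
have /fin_all_exists[t tE] (k : 'I_NV) : exists l : 'I_NV, vx l = s @: vx k.
  have iX : inX (s @: vx k) by rewrite inXs inX_vx.
  by have [l lE] := vx_surj iX; exists l.
have s_inj : injective (fun B : {set S} => s @: B) by apply: imset_inj.
have t_inj : injective t.
  by move=> k l e; apply: vx_inj; apply: s_inj; rewrite -!(tE) e.
have lenE (B : {set S}) : len (s @: B) = len B.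
  have cD (u v : {set S}) : #|s @: u :\: s @: v| = #|u :\: v|.
    rewrite -(card_imset (u :\: v) sI); apply: eq_card => k.
    by rewrite -(permKV s k) !(inE, mem_imset _ _ sI).
  by rewrite /len -{1 2}sx0 !cD.
have -> : i' = t i by apply: vx_inj; rewrite tE.
have -> : j' = t j by apply: vx_inj; rewrite tE.
move: A TA i j {i' j' iE jE}; apply: Terwilliger_ind.
- move=> i j; rewrite !mxE !tE /adjX !inXs.
  have pr (u v : {set S}) : (s @: u \proper s @: v) = (u \proper v).
    rewrite !properEcard !(card_imset _ sI).
    congr (_ && _); apply/idP/idP; last exact: imsetS.
    move/subsetP => uv; apply/subsetP => w wu; have := uv (s w).
    by rewrite !(mem_imset _ _ sI) wu; apply.
  by rewrite !pr.
- by move=> l i j; rewrite !EstarE (inj_eq t_inj) tE lenE.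
- by move=> i j; rewrite !mxE (inj_eq t_inj).
- by move=> A B IA IB i j; rewrite !mxE IA IB.
- by move=> c A IA i j; rewrite !mxE IA.
- move=> A B IA IB i j; rewrite !mxE (reindex_inj t_inj) /=.
  by apply: eq_bigr => k _; rewrite IA IB.
Qed.

(** Inverse of the map from [x] to its numbers of pairs [(pidx m x, qidx m x)]. *)
Definition pq_index p q : nat * nat :=
  if (q <= p)%N then (m - 2 * p, q)%N else (m.+1 - 2 * q, p)%N.

Lemma pq_indexP p q : (2 * p <= m)%N -> (2 * q <= m.+1)%N ->
  [/\ valid m (pq_index p q), pidx m (pq_index p q) = p & qidx m (pq_index p q) = q].
Proof.
rewrite /pq_index /valid /pidx /qidx => pm qm.
by case: (leqP q p) => pq /=; case: ifP => o; split; lia.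
Qed.

(* An orbit of the stabiliser of [x0] on pairs [(y, z)] is determined by [len y],
   [len z] and two intersection sizes; recentred at their least possible values,
   the latter become the parameters [p, q] of a module meeting both spheres. *)
Definition orbit_index (y z : {set S}) : nat * nat * nat * nat :=
  (pq_index (#|y :&: z :&: x0| - ((m - (len y)./2) + (m - (len z)./2) - m))
            (#|y :&: z :&: ~: x0| - (uphalf (len y) + uphalf (len z) - m.+1)),
   len y, len z)%N.

(** Inclusion-exclusion within [x0] and within its complement, with the sizes from [cards_inX]. *)
Lemma orbit_index_bounds (y z : {set S}) : inX y -> inX z ->
  let a := #|y :&: z :&: x0| in let b := #|y :&: z :&: ~: x0| in
  [/\ (m - (len y)./2 + (m - (len z)./2) - m <= a <= minn (m - (len y)./2) (m - (len z)./2))%N,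
      (uphalf (len y) + uphalf (len z) - m.+1 <= b <= minn (uphalf (len y)) (uphalf (len z)))%N,
      (len y <= 2 * m + 1)%N & (len z <= 2 * m + 1)%N].
Proof.
move=> iy iz; have [ly _ cy1 cy2] := cards_inX iy; have [lz _ cz1 cz2] := cards_inX iz.
have cI (D : {set S}) : (#|y :&: D| + #|z :&: D| - #|D| <= #|y :&: z :&: D|)%N /\
    (#|y :&: z :&: D| <= minn #|y :&: D| #|z :&: D|)%N.
  have e : y :&: z :&: D = (y :&: D) :&: (z :&: D).
    by apply/setP => i; rewrite !inE; case: (i \in D); rewrite ?andbF ?andbT.
  have := cardsUI (y :&: D) (z :&: D); rewrite -e.
  have : (#|(y :&: D) :|: (z :&: D)| <= #|D|)%N.
    by apply: subset_leq_card; rewrite subUset !subsetIr.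
  set a := #|_|; set b := #|_| => h1 h2; split; first by rewrite -h2 leq_subLR leq_add2r.
  by rewrite leq_min e !subset_leq_card ?subsetIl ?subsetIr.
have := cI x0; rewrite card_x0 cy1 cz1 => -[h1 h2].
have := cI (~: x0); rewrite card_x0C -!setDE cy2 cz2 => -[h3 h4].
by split=> //; apply/andP.
Qed.

(** For subsets of sizes [a] and [b] of an [n]-set, the intersection exceeds its least possible size
    by at most the minimum of [a], [b], [n - a], [n - b]. On the two sides of [x0] these are the
    inequalities of [suppE] at both distances. *)
Lemma orbit_indexP (y z : {set S}) : inX y -> inX z ->
  let q := orbit_index y z in
  [/\ valid m q.1.1, supp m q.1.1 q.1.2 & supp m q.1.1 q.2].
Proof.
move=> iy iz; have [] := orbit_index_bounds iy iz.
rewrite /orbit_index /=; set a := #|_|; set b := #|_|.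
move: (len y) (len z) a b => i k a b ha hb hi hk.
have [||vx pE qE] := @pq_indexP (a - (m - i./2 + (m - k./2) - m))
                                (b - (uphalf i + uphalf k - m.+1)).
- lia.
- lia.
by rewrite !suppE // pE qE; split=> //; lia.
Qed.

(** The recentring constants depend only on the two distances, so equal indices give equal
    intersection sizes. *)
Lemma orbit_index_inj (y z y' z' : {set S}) : inX y -> inX z -> inX y' -> inX z' ->
  orbit_index y z = orbit_index y' z' ->
  exists s : {perm S}, [/\ s @: x0 = x0, s @: y = y' & s @: z = z'].
Proof.
move=> iy iz iy' iz' [] pqE ly lz.
have [h1 h2 h3 h4] := orbit_index_bounds iy iz.
have [h1' h2' _ _] := orbit_index_bounds iy' iz'.
move: pqE h1' h2'; rewrite -ly -lz.
set a := #|y :&: z :&: x0| in h1 *; set b := #|y :&: z :&: ~: x0| in h2 *.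
set a' := #|y' :&: z' :&: x0|; set b' := #|y' :&: z' :&: ~: x0|.
pose a0 := (m - (len y)./2 + (m - (len z)./2) - m)%N.
pose b0 := (uphalf (len y) + uphalf (len z) - m.+1)%N.
rewrite -/a0 -/b0 => pqE h1' h2'; rewrite -/a0 in h1; rewrite -/b0 in h2.
have [||_ p1 q1] := @pq_indexP (a - a0) (b - b0); [lia | lia |].
have [||_ p2 q2] := @pq_indexP (a' - a0) (b' - b0); [lia | lia |].
have pE : (a - a0 = a' - a0)%N by rewrite -p1 -p2 pqE.
have qE : (b - b0 = b' - b0)%N by rewrite -q1 -q2 pqE.
apply: exists_perm_orbit => //; rewrite -/a -/b -/a' -/b'.
- lia.
- lia.
Qed.

End Orbits.

(** * The isomorphism *)

Section Faithful.
Variable m : nat.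
Notation NV := (NV m).
Notation T := (Terwilliger m).
Implicit Types (A B : 'M[CC]_NV).

Definition entry_ok (q : 'I_m.+1 * 'I_m.+1 * 'I_(2 * m + 2) * 'I_(2 * m + 2)) :=
  let: (d, r, i, k) := q in
  [&& valid m (nat_of_ord d, nat_of_ord r), supp m (nat_of_ord d, nat_of_ord r) i
    & supp m (nat_of_ord d, nat_of_ord r) k].

(** The matrix units of all the modules as a finite type, which also serves to label the orbits. *)
Definition entry := {q | entry_ok q}.

Definition entry_key (q : entry) : nat * nat * nat * nat :=
  let: (d, r, i, k) := val q in (nat_of_ord d, nat_of_ord r, nat_of_ord i, nat_of_ord k).

Lemma entry_keyP q : let t := entry_key q in
  [/\ valid m t.1.1, supp m t.1.1 t.1.2 & supp m t.1.1 t.2].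
Proof.
by rewrite /entry_key; case: q => -[[[d r] i] k] /= /and3P[].
Qed.

Lemma entry_key_inj : injective entry_key.
Proof.
move=> [[[[d r] i] k] h] [[[[d' r'] i'] k'] h'] /= [e1 e2 e3 e4].
by apply: val_inj => /=; congr (_, _, _, _); apply: val_inj.
Qed.

Lemma entry_key_surj t : valid m t.1.1 -> supp m t.1.1 t.1.2 -> supp m t.1.1 t.2 ->
  exists q, entry_key q = t.
Proof.
case: t => [[[d r] i] k] /= vx si sk.
have im := ltn_supp vx si; have km := ltn_supp vx sk.
have dm : (d < m.+1)%N by move: vx; rewrite /valid /=; lia.
have rm : (r < m.+1)%N by move: vx; rewrite /valid /=; lia.
have ok : entry_ok (Ordinal dm, Ordinal rm, Ordinal im, Ordinal km) by apply/and3P.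
by exists (exist (fun q => entry_ok q) _ ok).
Qed.

Definition orbit_mx (q : entry) : 'M[CC]_NV :=
  \matrix_(y, z) (entry_key q == orbit_index (vx y) (vx z))%:R.

Definition orbit_coef A (q : entry) : CC :=
  if [pick u : 'I_NV * 'I_NV | orbit_index (vx u.1) (vx u.2) == entry_key q] is Some u
  then A u.1 u.2 else 0.

(** By [orbit_indexP] every orbit has its label among the entries, and [A] is constant on orbits, so
    any representative gives the coefficient. *)
Lemma orbit_expansion A : T A -> A = \sum_q orbit_coef A q *: orbit_mx q.
Proof.
move=> TA; apply/matrixP => y z; rewrite summxE.
have [vq sq sq'] := orbit_indexP (inX_vx y) (inX_vx z).
have [q qE] := entry_key_surj vq sq sq'.
rewrite (bigD1 q) //= big1 ?addr0; last first.
  move=> q' q'q; rewrite !mxE -qE (inj_eq entry_key_inj) (negbTE q'q) mulr0 //.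
rewrite !mxE qE eqxx mulr1 /orbit_coef qE.
case: pickP => [[u v] /= /eqP uv|/(_ (y, z))]; last by rewrite eqxx.
have [s [sx su sv]] := orbit_index_inj (inX_vx u) (inX_vx v) (inX_vx y) (inX_vx z) uv.
exact: (Terwilliger_invariant sx TA).
Qed.

Definition entry_val A (q : entry) : CC :=
  let: (x, i, k) := entry_key q in modmx A x i k.

Lemma entry_val_lincomb (c : entry -> CC) (M : entry -> 'M[CC]_NV) q :
  entry_val (\sum_p c p *: M p) q = \sum_p c p * entry_val (M p) q.
Proof.
rewrite /entry_val; case: (entry_key q) => [[x i] k].
elim: (index_enum _) => [|p l IH]; last by rewrite !big_cons modmxD modmxZ IH.
by rewrite !big_nil -(scale0r (0 : 'M[CC]_NV)) modmxZ mul0r.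
Qed.

(* [T] lies in the span of the [orbit_mx q], and maps onto the functions on the same
   finite set of indices [q]: the square matrix of this map is therefore invertible. *)
Lemma modmx_faithful A : T A ->
  (forall x i k, valid m x -> supp m x i -> supp m x k -> modmx A x i k = 0) -> A = 0.
Proof.
move=> TA A0.
pose K : 'M[CC]_#|{: entry}| := \matrix_(a, b) entry_val (orbit_mx (enum_val a)) (enum_val b).
pose row_of B : 'rV[CC]_#|{: entry}| := \row_a orbit_coef B (enum_val a).
have rowK B : T B -> row_of B *m K = \row_b entry_val B (enum_val b).
  move=> TB; apply/rowP => b; rewrite !mxE {2}(orbit_expansion TB) entry_val_lincomb.
  rewrite [RHS](reindex_onto enum_val enum_rank) /=; last by move=> q _; rewrite enum_rankK.
  by apply: eq_big => [a|a _]; rewrite ?enum_valK ?eqxx // !mxE.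
(* The matrix units in [T] exhibit each row of the identity as a combination of rows of [K]. *)
have fullK : row_full K.
  rewrite -sub1mx; apply/row_subP => b; rewrite row1.
  have [vq sq sq'] := entry_keyP (enum_val b).
  have [U TU UE] := realized_unit vq sq sq'.
  apply/submxP; exists (row_of U); rewrite rowK //; apply/rowP => b'; rewrite !mxE /=.
  have [vq' s1 s2] := entry_keyP (enum_val b').
  rewrite /entry_val; move: vq' s1 s2 UE.
  rewrite -(inj_eq enum_val_inj) -(inj_eq entry_key_inj).
  case: (entry_key (enum_val b')) => [[x' i'] k'] /=.
  case: (entry_key (enum_val b)) => [[x i] k] /= v1 v2 v3 -> //.
  by rewrite /unit_entry !xpair_eqE andbA.
have freeK : row_free K by rewrite /row_free; move: fullK; rewrite /row_full.
have r0 : row_of A = 0.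
  apply/eqP; rewrite -(mulmx_free_eq0 _ freeK) rowK //; apply/eqP/rowP => b.
  rewrite !mxE /entry_val; have [v1 v2 v3] := entry_keyP (enum_val b).
  by case: (entry_key _) v1 v2 v3 => [[x i] k] /= v1 v2 v3; apply: A0.
rewrite (orbit_expansion TA) big1 // => q _.
have := congr1 (fun r : 'rV_ _ => r 0 (enum_rank q)) r0.
by rewrite !mxE enum_rankK => ->; rewrite scale0r.
Qed.

End Faithful.

(** * Assembling the modules into the list of blocks *)

Section Blocks.
Variable m : nat.
Notation NV := (NV m).
Notation T := (Terwilliger m).

Definition block_index : seq (nat * nat) :=
  [seq (d, r) | d <- iota 0 m.+1, r <- iota 0 (m - d - uphalf (m - d) + 1)].

Lemma block_dimsE : block_dims m = [seq 2 * x.1 + 2 | x <- block_index]%N.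
Proof.
rewrite /block_dims /block_index map_flatten -map_comp; congr flatten.
apply: eq_map => d /=; rewrite -map_comp.
rewrite -[X in nseq X _](size_iota 0).
by elim: (iota _ _) => //= r l ->.
Qed.

Lemma uniq_block_index : uniq block_index.
Proof.
apply: allpairs_uniq_dep => [|d _|]; try exact: iota_uniq.
by move=> [d r] [d' r'] _ _ /= [-> ->].
Qed.

Lemma mem_block_index x : (x \in block_index) = valid m x.
Proof.
apply/allpairsPdep/idP => [[d [r [+ + ->]]]|].
  by rewrite !mem_iota /valid /=; lia.
case: x => d r; rewrite /valid => h; exists d, r.
by rewrite !mem_iota; split=> //; move: h => /=; lia.
Qed.

Definition block_of (j : 'I_(size (block_dims m))) : nat * nat := nth (0, 0)%N block_index j.

Lemma ltn_block (j : 'I_(size (block_dims m))) : (j < size block_index)%N.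
Proof. by have := ltn_ord j; rewrite {2}block_dimsE size_map. Qed.

Lemma valid_block_of j : valid m (block_of j).
Proof. by rewrite -mem_block_index mem_nth // ltn_block. Qed.

Lemma block_of_inj : injective block_of.
Proof.
move=> i j /eqP; rewrite /block_of nth_uniq ?ltn_block ?uniq_block_index // => /eqP.
exact: val_inj.
Qed.

Lemma block_of_surj x : valid m x -> exists j, block_of j = x.
Proof.
rewrite -mem_block_index => xb.
have jlt : (index x block_index < size (block_dims m))%N.
  by rewrite block_dimsE size_map index_mem.
by exists (Ordinal jlt); rewrite /block_of nth_index.
Qed.

Lemma nth_block_dims (j : 'I_(size (block_dims m))) :
  nth 0%N (block_dims m) j = (2 * (block_of j).1 + 2)%N.
Proof. by rewrite {1}block_dimsE (nth_map (0, 0)%N) // ltn_block. Qed.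

Definition block_pos (j : 'I_(size (block_dims m))) (i : nat) := (m - (block_of j).1 + i)%N.

Lemma supp_block_pos (j : 'I_(size (block_dims m))) (i : 'I_(nth 0%N (block_dims m) j)) :
  supp m (block_of j) (block_pos j i).
Proof.
have := ltn_ord i; rewrite {2}nth_block_dims => ilt.
have := valid_block_of j; rewrite /valid /supp /block_pos; lia.
Qed.

Lemma block_pos_surj (j : 'I_(size (block_dims m))) i : supp m (block_of j) i ->
  exists a : 'I_(nth 0%N (block_dims m) j), block_pos j a = i.
Proof.
move=> si; have ilt : (i - (m - (block_of j).1) < nth 0%N (block_dims m) j)%N.
  by rewrite nth_block_dims; move: (valid_block_of j) si; rewrite /valid /supp; lia.
by exists (Ordinal ilt); move: si; rewrite /block_pos /supp /=; lia.
Qed.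

Lemma sum_block_pos (R : nmodType) (j : 'I_(size (block_dims m))) (g : nat -> R) :
  (forall i, ~~ supp m (block_of j) i -> g i = 0) ->
  \sum_(i < 2 * m + 2) g i = \sum_(a < nth 0%N (block_dims m) j) g (block_pos j a).
Proof.
move=> g0; have := valid_block_of j; rewrite /valid => /andP[dm _].
rewrite -(big_mkord xpredT g) -(big_mkord xpredT (fun a => g (block_pos j a))).
rewrite nth_block_dims; move: g0 dm; rewrite /supp /block_pos; set d := (block_of j).1 => g0 dm.
(* The range splits into the part below the support, the support from [m - d] to [m + d + 1], and
   the part above it; the outer parts vanish by [g0]. *)
rewrite (@big_cat_nat _ _ _ (m - d)) //=; last by lia.
rewrite (@big_cat_nat _ _ _ (m + d + 2) (m - d)) //=; [|by lia|by lia].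
rewrite big_nat_cond big1 ?add0r; last by move=> i hi; apply: g0; lia.
rewrite [X in _ + X]big_nat_cond [X in _ + X]big1 ?addr0; last by move=> i hi; apply: g0; lia.
rewrite -{1}[(m - d)%N]add0n big_addn (_ : m + d + 2 - (m - d) = 2 * d + 2)%N; last by lia.
by apply: eq_bigr => i _; rewrite addnC.
Qed.

Definition block_mx (A : 'M[CC]_NV) (j : 'I_(size (block_dims m))) :
    'M[CC]_(nth 0%N (block_dims m) j) :=
  \matrix_(a, b) modmx A (block_of j) (block_pos j a) (block_pos j b).

Lemma block_mx_mul A B j : T A -> T B -> block_mx (A *m B) j = block_mx A j *m block_mx B j.
Proof.
move=> TA TB; apply/matrixP => a b; rewrite !mxE.
rewrite modmx_mul ?valid_block_of ?supp_block_pos //.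
rewrite (@sum_block_pos _ j (fun i => modmx A _ _ i * modmx B _ i _)).
  by apply: eq_bigr => i _; rewrite !mxE.
by move=> i si; rewrite modmx_out ?mul0r // valid_block_of.
Qed.

Lemma block_mx1 j : block_mx 1%:M j = 1%:M.
Proof.
apply/matrixP => a b; rewrite !mxE modmx1 ?valid_block_of ?supp_block_pos //.
by rewrite /block_pos eqn_add2l.
Qed.

(** The blocks exhaust all module entries, so [modmx_faithful] applies to the difference, written
    [A + -1 *: B] to stay within the closure rules of [gen_alg]. *)
Lemma block_mx_inj A B : T A -> T B -> (forall j, block_mx A j = block_mx B j) -> A = B.
Proof.
move=> TA TB AB; apply/eqP; rewrite -subr_eq0 -scaleN1r; apply/eqP.
apply: modmx_faithful => [|x i k vx]; first by apply: gen_add => //; apply: gen_scale.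
have [j <-] := block_of_surj vx.
move=> /block_pos_surj[a <-] /block_pos_surj[b <-].
have /matrixP/(_ a b) := AB j; rewrite !mxE modmxD modmxZ => ->.
by rewrite mulN1r subrr.
Qed.

(** The entries of [g] serve as coefficients of the matrix units from [realized_unit]. *)
Lemma block_mx_surj (g : forall j : 'I_(size (block_dims m)), 'M[CC]_(nth 0%N (block_dims m) j)) :
  exists2 A, T A & forall j, block_mx A j = g j.
Proof.
have [A TA AE] : realized m (fun y i k => \sum_j \sum_a \sum_b
    g j a b * unit_entry (block_of j) (block_pos j a) (block_pos j b) y i k).
  apply: realized_sum => j; apply: realized_sum => a; apply: realized_sum => b.
  by apply: realizedZ; apply: realized_unit; rewrite ?valid_block_of ?supp_block_pos.
exists A => // j; apply/matrixP => a b; rewrite mxE.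
rewrite AE ?valid_block_of ?supp_block_pos //.
rewrite (bigD1 j) //= [X in _ + X]big1 ?addr0; last first.
  move=> j' jj'; apply: big1 => a' _; apply: big1 => b' _.
  by rewrite /unit_entry (inj_eq block_of_inj) eq_sym (negbTE jj') mulr0.
rewrite (bigD1 a) //= [X in _ + X]big1 ?addr0; last first.
  move=> a' aa'; apply: big1 => b' _.
  have /negbTE n : a != a' :> nat by rewrite eq_sym.
  by rewrite /unit_entry eqn_add2l n andbF mulr0.
rewrite (bigD1 b) //= [X in _ + X]big1 ?addr0; last first.
  move=> b' bb'.
  have /negbTE n : b != b' :> nat by rewrite eq_sym.
  by rewrite /unit_entry !eqn_add2l n !andbF mulr0.
by rewrite /unit_entry !eqxx mulr1.
Qed.

End Blocks.

Theorem theorem4p8 (m : nat) (hm : (3 <= m)%N) :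
  alg_iso_blocks (Terwilliger m) (block_dims m).
Proof.
exists (@block_mx m); split; first split.
- by move=> A B _ _ j; apply/matrixP => a b; rewrite !mxE modmxD.
- by move=> c A _ j; apply/matrixP => a b; rewrite !mxE modmxZ.
- by move=> A B TA TB j; apply: block_mx_mul.
- exact: block_mx1.
- exact: block_mx_inj.
- exact: block_mx_surj.
Qed.
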